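(* Let $L$ be a finite-dimensional Lie superalgebra over a field $\mathbb{F}$ of characteristic different from $2,3$. Up to Lie superalgebra isomorphisms, there are a unique multiplier and a unique cover of $L$, denoted by $\mathcal{M}(L)$ and $\mathcal{C}(L)$, respectively. Moreover, for any free presentation of $L$, $$0\longrightarrow R\longrightarrow F\longrightarrow L\longrightarrow 0$$ (that is, an extension of $L$ with $F$ a free Lie superalgebra), the following hold: (1) $\mathcal{M}(L)\cong (R\cap[F,F])/[R,F]$. (2) $\mathcal{C}(L)\cong Y/[R,F]$, where $X$ is a stem denominator of the free presentation and $Y$ is any subsuperspace of $F$ containing $[F,F]$ such that $F/[R,F]=X/[R,F]\oplus Y/[R,F]$ as superspaces.
   Context: All (super)spaces and (super)algebras are over $\mathbb{F}$. A superspace is a $\mathbb{Z}_2$-graded vector space; subsuperspaces, subalgebras and ideals are $\mathbb{Z}_2$-graded, and homomorphisms of Lie superalgebras are even linear maps preserving the bracket. The superdimension of a finite-dimensional superspace $V$ is $\mathrm{sdim}V=(\dim V_{\bar 0},\dim V_{\bar 1})$, and pairs are partially ordered by $(m,n)\le(k,l)\iff m\le k$ and $n\le l$. An extension of a Lie superalgebra $L$ by $A$ is a short exact sequence of Lie superalgebra homomorphisms $0\to A\to B\stackrel{\beta}{\to}L\to0$; $A$ is identified with an ideal of $B$. A stem extension of $L$ is an extension $0\to S\to T\to L\to 0$ with $S\subset \mathrm{Z}(T)$ and $S\subset[T,T]$. For finite-dimensional $L$, the kernel $S$ of any stem extension is finite-dimensional, with superdimension bounded in terms of $L$. A stem extension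 is called maximal if, among all the stem extensions of $L$, its kernel $S$ is of maximal superdimension with respect to the partial order on pairs given by $(m,n)\le(k,l)\iff m\le k$ and $n\le l$. If $0\to M\to C\to L\to0$ is a maximal stem extension of $L$, then $M$ is called a multiplier of $L$ and $C$ a cover of $L$. A stem denominator of an extension $0\to A\to B\to L\to0$ is a subsuperspace $X$ with $[A,B]\subset X\subset A$ such that $A/[A,B]=(A\cap[B,B])/[A,B]\oplus X/[A,B]$. *)

(* Defs.v *)
From HB Require Import structures.
From mathcomp Require Import all_boot all_order all_algebra.
From mathcomp Require Import boolp.

Set Implicit Arguments.
Unset Strict Implicit.
Unset Printing Implicit Defensive.

Import GRing.Theory.
Local Open Scope ring_scope.
Local Open Scope quotient_scope.

(* Parities are booleans: [false] is even, [true] is odd, parities add up by *)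
(* [(+)] and the sign (-1)^{ab} is [(-1) ^+ (a && b)].                        *)
HB.mixin Record Lmodule_isSuperspace (F : fieldType) V of GRing.Lmodule F V := {
  homog : bool -> {pred V};
  homog_submod_closed : forall b, submod_closed (homog b);
  homog_decomp : forall x : V, exists x0 x1,
    [/\ x0 \in homog false, x1 \in homog true & x = x0 + x1];
  homog_cap : forall x : V, x \in homog false -> x \in homog true -> x = 0
}.

#[short(type="superspaceType")]
HB.structure Definition Superspace (F : fieldType) :=
  {V of GRing.Lmodule F V & Lmodule_isSuperspace F V}.

(* These axioms are adequate in characteristic different from 2 and 3. In     *)
(* characteristic 3 one also requires [x, [x, x]] = 0 for x odd, and more is  *)
(* needed in characteristic 2.                                                *)
HB.mixin Record Superspace_isLieSuperalg (F : fieldType) L of Superspace F L :=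
{
  brk : L -> L -> L;
  brk_linearl : forall z : L, linear (fun x => brk x z);
  brk_linearr : forall z : L, linear (brk z);
  brk_homog : forall a b (x y : L), x \in homog a -> y \in homog b ->
    brk x y \in homog (a (+) b);
  brk_skew : forall a b (x y : L), x \in homog a -> y \in homog b ->
    brk x y = - ((-1) ^+ (a && b) *: brk y x);
  brk_jacobi : forall a b c (x y z : L),
    x \in homog a -> y \in homog b -> z \in homog c ->
    brk x (brk y z) = brk (brk x y) z + (-1) ^+ (a && b) *: brk y (brk x z)
}.

#[short(type="lieSuperalgType")]
HB.structure Definition LieSuperalg (F : fieldType) :=
  {L of Superspace F L & Superspace_isLieSuperalg F L}.

Arguments homog_cap {F s} [x].
Arguments brk_homog {F s} [a b x y].
Arguments brk_skew {F s} [a b x y].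
Arguments brk_jacobi {F s} [a b c x y z].

Notation "\[ x , y ]" := (brk x y) (at level 0, x, y at level 99,
  format "\[ x ,  y ]") : ring_scope.

Section Subspaces.
Variables (F : fieldType) (V : lmodType F) (S : submodClosed V).

Lemma subspB x y : x \in S -> y \in S -> x - y \in S.
Proof. by move=> Sx Sy; rewrite -scaleN1r rpredD ?rpredZ. Qed.

Let memS : {pred V} := fun x => x \in S.

Let memS_closed : zmod_closed memS := conj (rpred0 S) subspB.

Definition subsp_zmod : zmodClosed V :=
  HB.pack memS (GRing.isZmodClosed.Build V memS memS_closed).

Record subsp := Subsp { subsp_val : V; subsp_valP : subsp_val \in S }.

HB.instance Definition _ := [isSub for subsp_val].
HB.instance Definition _ := [Choice of subsp by <:].
HB.instance Definition _ :=
  GRing.SubChoice_isSubLmodule.Build F V _ subsp (submodClosedP S).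

Definition lquot := Quotient.quot subsp_zmod.

HB.instance Definition _ := GRing.Zmodule.on lquot.

Definition lquot_pi (x : V) : lquot := \pi_(Quotient.quot subsp_zmod) x.

Lemma lquot_pi_eq x y : lquot_pi x = lquot_pi y <-> x - y \in S.
Proof.
have e : (x - y \in S) = (lquot_pi x == lquot_pi y).
  exact: (Quotient.idealrBE subsp_zmod x y).
by rewrite e; split=> /eqP.
Qed.

Lemma lquot_surj (q : lquot) : exists x, lquot_pi x = q.
Proof. by exists (repr q); exact: reprK. Qed.

Lemma lquot_piD x y : lquot_pi (x + y) = lquot_pi x + lquot_pi y.
Proof. exact: (Quotient.pi_add subsp_zmod). Qed.

Lemma lquot_piB x y : lquot_pi (x - y) = lquot_pi x - lquot_pi y.
Proof.
rewrite lquot_piD; congr (_ + _); exact: (Quotient.pi_opp subsp_zmod).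
Qed.

Lemma lquot_pi0 : lquot_pi 0 = 0.
Proof. by rewrite -(subrr 0) lquot_piB subrr. Qed.

Definition lquot_scale (a : F) (q : lquot) : lquot := lquot_pi (a *: repr q).

Lemma lquot_repr x : repr (lquot_pi x) - x \in S.
Proof. by apply/lquot_pi_eq; exact: reprK. Qed.

Lemma lquot_scaleE a x : lquot_scale a (lquot_pi x) = lquot_pi (a *: x).
Proof. by apply/lquot_pi_eq; rewrite -scalerBr rpredZ ?lquot_repr. Qed.

Fact lquot_scaleA a b q :
  lquot_scale a (lquot_scale b q) = lquot_scale (a * b) q.
Proof. by case: (lquot_surj q) => x <-; rewrite !lquot_scaleE scalerA. Qed.

Fact lquot_scale1 : left_id 1 lquot_scale.
Proof. by move=> q; case: (lquot_surj q) => x <-; rewrite lquot_scaleE scale1r. Qed.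

Fact lquot_scaleDr : right_distributive lquot_scale +%R.
Proof.
move=> a q r; case: (lquot_surj q) (lquot_surj r) => x <- [y <-].
by rewrite -lquot_piD !lquot_scaleE scalerDr lquot_piD.
Qed.

Fact lquot_scaleDl q : {morph lquot_scale^~ q : a b / a + b}.
Proof.
by move=> a b; case: (lquot_surj q) => x <-; rewrite !lquot_scaleE scalerDl lquot_piD.
Qed.

HB.instance Definition _ := GRing.Zmodule_isLmodule.Build F lquot
  lquot_scaleA lquot_scale1 lquot_scaleDr lquot_scaleDl.

Fact lquot_pi_linear : linear lquot_pi.
Proof. by move=> a x y; rewrite lquot_piD -lquot_scaleE. Qed.

HB.instance Definition _ :=
  GRing.isLinear.Build F V lquot *:%R lquot_pi lquot_pi_linear.

Lemma lquot_pi_eq0 x : lquot_pi x = 0 <-> x \in S.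
Proof. by rewrite -lquot_pi0 lquot_pi_eq subr0. Qed.

End Subspaces.

Section Superspaces.
Variables (F : fieldType) (V : superspaceType F).

Definition homog_space (b : bool) : submodClosed V :=
  HB.pack (homog b : {pred V})
    (GRing.isSubmodClosed.Build F V (homog b) (homog_submod_closed b)).

Record subsuperspace := Subsuperspace {
  ss_space :> submodClosed V;
  ss_graded : forall x, x \in ss_space -> exists x0 x1,
    [/\ x0 \in ss_space, x1 \in ss_space, x0 \in homog false,
        x1 \in homog true & x = x0 + x1]
}.

Lemma ss0 (K : subsuperspace) : 0 \in K.
Proof. exact: rpred0. Qed.

Lemma ssD (K : subsuperspace) x y : x \in K -> y \in K -> x + y \in K.
Proof. exact: rpredD. Qed.

Lemma ssZ (K : subsuperspace) a x : x \in K -> a *: x \in K.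
Proof. exact: rpredZ. Qed.

Lemma ss_sum (K : subsuperspace) (T : eqType) (s : seq T) (f : T -> V) :
  (forall p, p \in s -> f p \in K) -> \sum_(p <- s) f p \in K.
Proof. by move=> Kf; rewrite big_seq; apply: rpred_sum. Qed.

Lemma homog0 b : (0 : V) \in homog b.
Proof. exact: (rpred0 (homog_space b)). Qed.

Lemma homogD b (x y : V) : x \in homog b -> y \in homog b -> x + y \in homog b.
Proof. exact: (@rpredD _ (homog_space b)). Qed.

Lemma homogZ b a (x : V) : x \in homog b -> a *: x \in homog b.
Proof. exact: (@rpredZ _ _ (homog_space b)). Qed.

Lemma homogB b (x y : V) : x \in homog b -> y \in homog b -> x - y \in homog b.
Proof. exact: (@subspB _ _ (homog_space b)). Qed.

Lemma homog_uniq (x0 x1 y0 y1 : V) :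
  x0 \in homog false -> x1 \in homog true ->
  y0 \in homog false -> y1 \in homog true ->
  x0 + x1 = y0 + y1 -> x0 = y0 /\ x1 = y1.
Proof.
move=> hx0 hx1 hy0 hy1 e.
have e' : x0 - y0 = y1 - x1.
  by apply/eqP; rewrite subr_eq addrAC eq_sym subr_eq e addrC.
have z : x0 - y0 = 0.
  by apply: homog_cap; [rewrite homogB | rewrite e' homogB].
split; first by apply/eqP; rewrite -subr_eq0 z.
by apply/eqP; rewrite eq_sym -subr_eq0 -e' z.
Qed.

End Superspaces.

Section SubSuperspace.
Variables (F : fieldType) (V : superspaceType F) (K : subsuperspace V).

Definition subsp_homog (b : bool) : {pred subsp K} :=
  [pred x | subsp_val x \in homog b].

Fact subsp_homog_closed b : submod_closed (subsp_homog b).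
Proof.
split; first by rewrite !inE homog0.
by move=> a x y; rewrite !inE => hx hy; rewrite homogD ?homogZ.
Qed.

Fact subsp_homog_decomp (x : subsp K) : exists x0 x1,
  [/\ x0 \in subsp_homog false, x1 \in subsp_homog true & x = x0 + x1].
Proof.
case: x => x Kx; have [x0 [x1 [K0 K1 h0 h1 e]]] := ss_graded Kx.
by exists (Subsp K0), (Subsp K1); split=> //; apply: val_inj.
Qed.

Fact subsp_homog_cap (x : subsp K) :
  x \in subsp_homog false -> x \in subsp_homog true -> x = 0.
Proof. by move=> h0 h1; apply: val_inj; apply: homog_cap. Qed.

HB.instance Definition _ := Lmodule_isSuperspace.Build F (subsp K)
  subsp_homog_closed subsp_homog_decomp subsp_homog_cap.

Definition lquot_homog (b : bool) : {pred lquot K} :=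
  [pred q | `[< exists2 x : V, x \in homog b & lquot_pi K x = q >]].

Lemma lquot_homogP b q :
  reflect (exists2 x : V, x \in homog b & lquot_pi K x = q) (q \in lquot_homog b).
Proof. by rewrite inE; exact: asboolP. Qed.

Fact lquot_homog_closed b : submod_closed (lquot_homog b).
Proof.
split; first by apply/lquot_homogP; exists 0; rewrite ?homog0 ?lquot_pi0.
move=> a q r /lquot_homogP[x hx <-] /lquot_homogP[y hy <-].
by apply/lquot_homogP; exists (a *: x + y); rewrite ?homogD ?homogZ // linearP.
Qed.

Fact lquot_homog_decomp (q : lquot K) : exists q0 q1,
  [/\ q0 \in lquot_homog false, q1 \in lquot_homog true & q = q0 + q1].
Proof.
case: (lquot_surj q) => x <-; have [x0 [x1 [h0 h1 ->]]] := homog_decomp x.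
exists (lquot_pi K x0), (lquot_pi K x1); split; last exact: lquot_piD.
  by apply/lquot_homogP; exists x0.
by apply/lquot_homogP; exists x1.
Qed.

Fact lquot_homog_cap (q : lquot K) :
  q \in lquot_homog false -> q \in lquot_homog true -> q = 0.
Proof.
move=> /lquot_homogP[x hx <-] /lquot_homogP[y hy e].
have /ss_graded[u [v [Ku Kv hu hv]]] : x - y \in K.
  by apply/lquot_pi_eq; rewrite e.
have hNy : - y \in homog true by rewrite -[- y]sub0r homogB ?homog0.
by move=> /(homog_uniq hx hNy hu hv)[-> _]; apply/lquot_pi_eq0.
Qed.

HB.instance Definition _ := Lmodule_isSuperspace.Build F (lquot K)
  lquot_homog_closed lquot_homog_decomp lquot_homog_cap.

End SubSuperspace.

Section Subalgebras.
Variables (F : fieldType) (L : lieSuperalgType F).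

Record subalgebra := Subalgebra {
  sa_space :> subsuperspace L;
  sa_closed : forall x y, x \in sa_space -> y \in sa_space ->
    \[x, y] \in sa_space
}.

Record ideal := Ideal {
  id_subalg :> subalgebra;
  id_closedl : forall x y, x \in id_subalg -> \[x, y] \in id_subalg;
  id_closedr : forall x y, y \in id_subalg -> \[x, y] \in id_subalg
}.

Lemma brkDl (x y z : L) : \[x + y, z] = \[x, z] + \[y, z].
Proof. by have := brk_linearl z 1 x y; rewrite !scale1r. Qed.

Lemma brkDr (x y z : L) : \[x, y + z] = \[x, y] + \[x, z].
Proof. by have := brk_linearr x 1 y z; rewrite !scale1r. Qed.

Lemma brk0l (x : L) : \[0, x] = 0.
Proof. by apply: (addrI \[0, x]); rewrite -brkDl !addr0. Qed.

Lemma brk0r (x : L) : \[x, 0] = 0.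
Proof. by apply: (addrI \[x, 0]); rewrite -brkDr !addr0. Qed.

Lemma brkZl a (x y : L) : \[a *: x, y] = a *: \[x, y].
Proof. by have := brk_linearl y a x 0; rewrite brk0l !addr0. Qed.

Lemma brkZr a (x y : L) : \[x, a *: y] = a *: \[x, y].
Proof. by have := brk_linearr x a y 0; rewrite brk0r !addr0. Qed.

Lemma brkBl (x y z : L) : \[x - y, z] = \[x, z] - \[y, z].
Proof. by rewrite -scaleN1r brkDl brkZl scaleN1r. Qed.

Lemma brkBr (x y z : L) : \[x, y - z] = \[x, y] - \[x, z].
Proof. by rewrite -scaleN1r brkDr brkZr scaleN1r. Qed.

Definition center : {pred L} := [pred x | `[< forall y : L, \[x, y] = 0 >]].

Section Commutator.
Variables A B : subsuperspace L.

(* As A is a subspace, linear combinations of brackets are sums of brackets.  *)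
Definition comm_mem : L -> bool := fun x =>
  `[< exists s : seq (L * L),
        (forall p, p \in s -> p.1 \in A /\ p.2 \in B) /\
        x = \sum_(p <- s) \[p.1, p.2] >].

Lemma comm_memP x : reflect (exists s : seq (L * L),
    (forall p, p \in s -> p.1 \in A /\ p.2 \in B) /\
    x = \sum_(p <- s) \[p.1, p.2]) (x \in comm_mem).
Proof. exact: asboolP. Qed.

Fact comm_closed : submod_closed comm_mem.
Proof.
split; first by apply/comm_memP; exists [::]; rewrite big_nil.
move=> a _ _ /comm_memP[s [sP ->]] /comm_memP[t [tP ->]]; apply/comm_memP.
exists ([seq (a *: p.1, p.2) | p <- s] ++ t); split=> [p|].
  rewrite mem_cat => /orP[/mapP[q /sP[qA qB] ->]|/tP//].
  by split=> //; apply: rpredZ.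
rewrite big_cat /= big_map scaler_sumr; congr (_ + _).
by apply: eq_bigr => p _; rewrite brkZl.
Qed.

Definition comm_space : submodClosed L :=
  HB.pack comm_mem (GRing.isSubmodClosed.Build F L comm_mem comm_closed).

Lemma mem_comm x y : x \in A -> y \in B -> \[x, y] \in comm_space.
Proof.
move=> Ax By; apply/comm_memP; exists [:: (x, y)]; rewrite big_seq1.
by split=> // p; rewrite inE => /eqP->.
Qed.

Fact comm_graded x : x \in comm_space -> exists x0 x1,
  [/\ x0 \in comm_space, x1 \in comm_space, x0 \in homog false,
      x1 \in homog true & x = x0 + x1].
Proof.
move=> /comm_memP[s [sP ->]]; elim: s sP => [|[a b] s IHs] sP.
  by exists 0, 0; rewrite big_nil addr0 rpred0 !homog0.
have [|u0 [u1 [C0 C1 h0 h1 e]]] := IHs.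
  by move=> p sp; apply: sP; rewrite inE sp orbT.
have [/= Aa Bb] : (a, b).1 \in A /\ (a, b).2 \in B by apply: sP; rewrite mem_head.
have [a0 [a1 [Aa0 Aa1 ha0 ha1 ->]]] := ss_graded Aa.
have [b0 [b1 [Bb0 Bb1 hb0 hb1 ->]]] := ss_graded Bb.
have e0 : \[a0, b0] + \[a1, b1] + u0 \in comm_space by rewrite !rpredD ?mem_comm.
have e1 : \[a0, b1] + \[a1, b0] + u1 \in comm_space by rewrite !rpredD ?mem_comm.
exists (\[a0, b0] + \[a1, b1] + u0), (\[a0, b1] + \[a1, b0] + u1); split=> //.
- by apply: (homogD _ h0); apply: homogD; [exact: (brk_homog ha0 hb0) | exact: (brk_homog ha1 hb1)].
- by apply: (homogD _ h1); apply: homogD; [exact: (brk_homog ha0 hb1) | exact: (brk_homog ha1 hb0)].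
rewrite big_cons /= e !(brkDl, brkDr) [RHS]addrACA; congr (_ + _).
rewrite -!addrA; congr (_ + _).
by rewrite addrA addrC.
Qed.

Definition comm_ss : subsuperspace L := Subsuperspace comm_graded.

End Commutator.

Definition full_mem : L -> bool := fun=> true.

Fact full_closed : submod_closed full_mem. Proof. by []. Qed.

Definition full_space : submodClosed L :=
  HB.pack full_mem (GRing.isSubmodClosed.Build F L full_mem full_closed).

Fact full_graded x : x \in full_space -> exists x0 x1,
  [/\ x0 \in full_space, x1 \in full_space, x0 \in homog false,
      x1 \in homog true & x = x0 + x1].
Proof. by move=> _; have [x0 [x1 [? ? ->]]] := homog_decomp x; exists x0, x1. Qed.

Definition full_subalg : subalgebra :=
  @Subalgebra (Subsuperspace full_graded) (fun _ _ _ _ => erefl true).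

Definition full : ideal :=
  @Ideal full_subalg (fun _ _ _ => erefl true) (fun _ _ _ => erefl true).

Section Cap.
Variables A B : subsuperspace L.

Definition cap_mem : L -> bool := fun x => (x \in A) && (x \in B).

Fact cap_closed : submod_closed cap_mem.
Proof.
split; first by rewrite -topredE /= /cap_mem !rpred0.
move=> a x y; rewrite -!topredE /= /cap_mem => /andP[? ?] /andP[? ?].
by rewrite !rpredD ?rpredZ.
Qed.

Definition cap_space : submodClosed L :=
  HB.pack cap_mem (GRing.isSubmodClosed.Build F L cap_mem cap_closed).

Lemma mem_cap x : (x \in cap_space) = (x \in A) && (x \in B).
Proof. by []. Qed.

Fact cap_graded x : x \in cap_space -> exists x0 x1,
  [/\ x0 \in cap_space, x1 \in cap_space, x0 \in homog false,
      x1 \in homog true & x = x0 + x1].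
Proof.
rewrite mem_cap => /andP[/ss_graded[x0 [x1 [A0 A1 h0 h1 ->]]]].
move=> /ss_graded[y0 [y1 [B0 B1 k0 k1]]] /(homog_uniq h0 h1 k0 k1)[e0 e1].
by exists x0, x1; rewrite !mem_cap A0 A1 e0 e1 B0 B1 -e0 -e1.
Qed.

Definition cap_ss : subsuperspace L := Subsuperspace cap_graded.

End Cap.

Fact cap_sa_closed (A B : subalgebra) x y :
  x \in cap_ss A B -> y \in cap_ss A B -> \[x, y] \in cap_ss A B.
Proof.
by rewrite !mem_cap => /andP[? ?] /andP[? ?]; rewrite !sa_closed.
Qed.

Definition cap_subalg (A B : subalgebra) : subalgebra :=
  Subalgebra (@cap_sa_closed A B).

Lemma closed_swap (C : subsuperspace L) :
  (forall x y, y \in C -> \[x, y] \in C) ->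
  forall x y, x \in C -> \[x, y] \in C.
Proof.
move=> Cr x y Cx; have [x0 [x1 [C0 C1 h0 h1 ->]]] := ss_graded Cx.
have [y0 [y1 [k0 k1 ->]]] := homog_decomp y.
have swap a b u v : u \in homog a -> v \in homog b -> u \in C -> \[u, v] \in C.
  by move=> hu hv Cu; rewrite (brk_skew hu hv) -scaleN1r; do 2!apply: ssZ; exact: Cr.
rewrite !(brkDl, brkDr); do 2?apply: ssD.
- exact: (swap _ _ _ _ h0 k0).
- exact: (swap _ _ _ _ h0 k1).
- exact: (swap _ _ _ _ h1 k0).
- exact: (swap _ _ _ _ h1 k1).
Qed.

Section CommIdeal.
Variables I J : ideal.

Fact comm_idr x y : y \in comm_ss I J -> \[x, y] \in comm_ss I J.
Proof.
suff main u v : u \in I -> v \in J -> \[x, \[u, v]] \in comm_ss I J.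
  move=> /comm_memP[s [sP ->]].
  rewrite (big_morph (brk x) (brkDr x) (brk0r x)).
  by apply: ss_sum => p /sP[]; exact: main.
move=> Iu Jv.
have [x0 [x1 [h0 h1 ->]]] := homog_decomp x.
have [u0 [u1 [I0 I1 k0 k1 ->]]] := ss_graded Iu.
have jac a b z w : z \in homog a -> w \in homog b -> w \in I ->
    \[z, \[w, v]] \in comm_ss I J.
  move=> hz hw Iw; have [v0 [v1 [J0 J1 l0 l1 ->]]] := ss_graded Jv.
  rewrite !brkDr (brk_jacobi hz hw l0) (brk_jacobi hz hw l1).
  by do 2?apply: ssD; try apply: ssZ; apply: mem_comm => //; exact: id_closedr.
rewrite [\[u0 + u1, v]]brkDl brkDl !brkDr; do 2?apply: ssD.
- exact: (jac _ _ _ _ h0 k0).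
- exact: (jac _ _ _ _ h0 k1).
- exact: (jac _ _ _ _ h1 k0).
- exact: (jac _ _ _ _ h1 k1).
Qed.

Definition comm_subalg : subalgebra :=
  @Subalgebra (comm_ss I J) (fun x y _ => @comm_idr x y).

Definition comm : ideal :=
  @Ideal comm_subalg (closed_swap comm_idr) comm_idr.

End CommIdeal.

Definition derived : ideal := comm full full.

Definition subalg_of_derived (Y : subsuperspace L)
    (hY : {subset derived <= Y}) : subalgebra :=
  @Subalgebra Y (fun x y _ _ => hY _ (@mem_comm full full x y isT isT)).

End Subalgebras.

Arguments center {F} L _.
Arguments full {F} L.
Arguments derived {F} L.

Section SubLie.
Variables (F : fieldType) (L : lieSuperalgType F) (K : subalgebra L).

Definition sub_brk (x y : subsp K) : subsp K :=
  Subsp (sa_closed (subsp_valP x) (subsp_valP y)).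

Fact sub_brk_linearl z : linear (fun x => sub_brk x z).
Proof. by move=> a x y; apply: val_inj; rewrite /= brkDl brkZl. Qed.

Fact sub_brk_linearr z : linear (sub_brk z).
Proof. by move=> a x y; apply: val_inj; rewrite /= brkDr brkZr. Qed.

Fact sub_brk_homog a b (x y : subsp K) :
  x \in homog a -> y \in homog b -> sub_brk x y \in homog (a (+) b).
Proof. exact: brk_homog. Qed.

Fact sub_brk_skew a b (x y : subsp K) : x \in homog a -> y \in homog b ->
  sub_brk x y = - ((-1) ^+ (a && b) *: sub_brk y x).
Proof. by move=> hx hy; apply: val_inj; exact: brk_skew. Qed.

Fact sub_brk_jacobi a b c (x y z : subsp K) :
  x \in homog a -> y \in homog b -> z \in homog c ->
  sub_brk x (sub_brk y z) = sub_brk (sub_brk x y) z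
    + (-1) ^+ (a && b) *: sub_brk y (sub_brk x z).
Proof. by move=> hx hy hz; apply: val_inj; exact: (brk_jacobi hx hy hz). Qed.

HB.instance Definition _ := Superspace_isLieSuperalg.Build F (subsp K)
  sub_brk_linearl sub_brk_linearr sub_brk_homog sub_brk_skew sub_brk_jacobi.

Definition sub_lie : lieSuperalgType F := subsp K.

End SubLie.

Section QuotLie.
Variables (F : fieldType) (L : lieSuperalgType F) (I : ideal L).

Definition quot_brk (q r : lquot I) : lquot I :=
  lquot_pi I \[repr q, repr r].

Lemma quot_brkE x y : quot_brk (lquot_pi I x) (lquot_pi I y) = lquot_pi I \[x, y].
Proof.
apply/lquot_pi_eq; set x' := repr _; set y' := repr _.
have -> : \[x', y'] - \[x, y] = \[x' - x, y'] + \[x, y' - y].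
  by rewrite brkBl brkBr addrA subrK.
by apply: ssD; [apply: id_closedl | apply: id_closedr]; exact: lquot_repr.
Qed.

Fact quot_brk_linearl r : linear (fun q => quot_brk q r).
Proof.
move=> a p q; case: (lquot_surj p) (lquot_surj q) (lquot_surj r) => x <- [y <-] [z <-].
by rewrite -linearP !quot_brkE -linearP brkDl brkZl.
Qed.

Fact quot_brk_linearr r : linear (quot_brk r).
Proof.
move=> a p q; case: (lquot_surj p) (lquot_surj q) (lquot_surj r) => x <- [y <-] [z <-].
by rewrite -linearP !quot_brkE -linearP brkDr brkZr.
Qed.

Fact quot_brk_homog a b (q r : lquot I) :
  q \in homog a -> r \in homog b -> quot_brk q r \in homog (a (+) b).
Proof.
move=> /lquot_homogP[x hx <-] /lquot_homogP[y hy <-]; rewrite quot_brkE.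
by apply/lquot_homogP; exists \[x, y] => //; exact: brk_homog.
Qed.

Fact quot_brk_skew a b (q r : lquot I) : q \in homog a -> r \in homog b ->
  quot_brk q r = - ((-1) ^+ (a && b) *: quot_brk r q).
Proof.
move=> /lquot_homogP[x hx <-] /lquot_homogP[y hy <-]; rewrite !quot_brkE.
by rewrite (brk_skew hx hy) linearN linearZ.
Qed.

Fact quot_brk_jacobi a b c (p q r : lquot I) :
  p \in homog a -> q \in homog b -> r \in homog c ->
  quot_brk p (quot_brk q r) = quot_brk (quot_brk p q) r
    + (-1) ^+ (a && b) *: quot_brk q (quot_brk p r).
Proof.
move=> /lquot_homogP[x hx <-] /lquot_homogP[y hy <-] /lquot_homogP[z hz <-].
by rewrite !quot_brkE (brk_jacobi hx hy hz) linearD linearZ.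
Qed.

HB.instance Definition _ := Superspace_isLieSuperalg.Build F (lquot I)
  quot_brk_linearl quot_brk_linearr quot_brk_homog quot_brk_skew quot_brk_jacobi.

Definition quot_lie : lieSuperalgType F := lquot I.

End QuotLie.

Record lieHom (F : fieldType) (A B : lieSuperalgType F) := LieHom {
  lie_fun :> {linear A -> B};
  lie_homog : forall b x, x \in homog b -> lie_fun x \in homog b;
  lie_brk : forall x y, lie_fun \[x, y] = \[lie_fun x, lie_fun y]
}.

Definition lie_iso (F : fieldType) (A B : lieSuperalgType F) : Prop :=
  exists f : lieHom A B, bijective f.

Section Image.
Variables (F : fieldType) (A B : lieSuperalgType F) (f : lieHom A B).

Section ImageSpace.
Variable K : subsuperspace A.

Definition img_mem : B -> bool := fun y => `[< exists2 x, x \in K & f x = y >].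

Lemma img_memP y : reflect (exists2 x, x \in K & f x = y) (y \in img_mem).
Proof. exact: asboolP. Qed.

Fact img_closed : submod_closed img_mem.
Proof.
split; first by apply/img_memP; exists 0; [exact: ss0 | exact: raddf0].
move=> a _ _ /img_memP[x Kx <-] /img_memP[y Ky <-].
by apply/img_memP; exists (a *: x + y); [apply: ssD; first exact: ssZ | exact: linearP].
Qed.

Definition img_space : submodClosed B :=
  HB.pack img_mem (GRing.isSubmodClosed.Build F B img_mem img_closed).

Fact img_graded y : y \in img_space -> exists y0 y1,
  [/\ y0 \in img_space, y1 \in img_space, y0 \in homog false,
      y1 \in homog true & y = y0 + y1].
Proof.
move=> /img_memP[x /ss_graded[x0 [x1 [K0 K1 h0 h1 ->]]] <-].
exists (f x0), (f x1); split; try exact: lie_homog; last exact: raddfD.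
  by apply/img_memP; exists x0.
by apply/img_memP; exists x1.
Qed.

Definition img_ss : subsuperspace B := Subsuperspace img_graded.

End ImageSpace.

Variable K : subalgebra A.

Fact img_sa_closed x y : x \in img_ss K -> y \in img_ss K -> \[x, y] \in img_ss K.
Proof.
move=> /img_memP[u Ku <-] /img_memP[v Kv <-]; apply/img_memP.
by exists \[u, v]; rewrite ?lie_brk ?sa_closed.
Qed.

Definition img_subalg : subalgebra B := Subalgebra img_sa_closed.

End Image.

Section QuotMap.
Variables (F : fieldType) (L : lieSuperalgType F) (I : ideal L).

Fact quot_map_homog b x : x \in homog b -> lquot_pi I x \in homog b.
Proof. by move=> hx; apply/lquot_homogP; exists x. Qed.

Fact quot_map_brk x y :
  lquot_pi I \[x, y] = \[lquot_pi I x, lquot_pi I y].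
Proof. by rewrite -quot_brkE. Qed.

Definition quot_map : lieHom L (quot_lie I) :=
  @LieHom F L (quot_lie I) (lquot_pi I) quot_map_homog quot_map_brk.

(* K / I is the image of K in L / I; these are only used when I is contained  *)
(* in K.                                                                      *)
Definition quot_ss (K : subsuperspace L) : subsuperspace (quot_lie I) :=
  img_ss quot_map K.

Definition quot_sub_lie (K : subalgebra L) : lieSuperalgType F :=
  sub_lie (img_subalg quot_map K).

End QuotMap.

Definition is_direct_sum (F : fieldType) (V : superspaceType F)
    (W U1 U2 : subsuperspace V) : Prop :=
  (forall w, w \in W <-> exists u1 u2, [/\ u1 \in U1, u2 \in U2 & w = u1 + u2])
  /\ (forall w, w \in U1 -> w \in U2 -> w = 0).

Definition finite_dimensional (F : fieldType) (V : lmodType F) : Prop :=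
  exists n, inhabited (Vector.axiom n V).

Definition has_sdim (F : fieldType) (V : superspaceType F) (d : nat * nat) : Prop :=
  inhabited (Vector.axiom d.1 (subsp (homog_space V false))) /\
  inhabited (Vector.axiom d.2 (subsp (homog_space V true))).

Definition sdim_le (d e : nat * nat) : bool := (d.1 <= e.1)%N && (d.2 <= e.2)%N.

Record extension (F : fieldType) (A B L : lieSuperalgType F) := Extension {
  ext_inj : lieHom A B;
  ext_proj : lieHom B L;
  ext_inj_injective : injective ext_inj;
  ext_proj_surjective : forall y, exists x, ext_proj x = y;
  ext_exact : forall x, ext_proj x = 0 <-> exists a, ext_inj a = x
}.

Section Extensions.
Variables (F : fieldType) (A B L : lieSuperalgType F) (E : extension A B L).

Fact ext_idr x y : y \in img_ss (ext_inj E) (full A) ->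
  \[x, y] \in img_ss (ext_inj E) (full A).
Proof.
move=> /img_memP[a _ <-]; apply/img_memP.
have : ext_proj E \[x, ext_inj E a] = 0.
  have -> // : ext_proj E \[x, ext_inj E a] = \[ext_proj E x, 0].
    by rewrite lie_brk; congr brk; apply/(ext_exact E); exists a.
  exact: brk0r.
by move=> /(ext_exact E)[b <-]; exists b.
Qed.

(* The kernel A of the extension, identified with its image in B.             *)
Definition ext_ideal : ideal B :=
  @Ideal _ B (img_subalg (ext_inj E) (full A)) (closed_swap ext_idr) ext_idr.

Definition is_stem : Prop :=
  {subset ext_ideal <= center B} /\ {subset ext_ideal <= derived B}.

Definition is_stem_denominator (X : subsuperspace B) : Prop :=
  let AB := comm ext_ideal (full B) in
  [/\ {subset AB <= X}, {subset X <= ext_ideal} &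
      is_direct_sum (quot_ss AB ext_ideal)
        (quot_ss AB (cap_ss ext_ideal (derived B))) (quot_ss AB X)].

End Extensions.

(* "Maximal superdimension" is maximality for the (partial) order on the set  *)
(* of superdimensions of the kernels of the stem extensions of L.             *)
Definition is_maximal_stem (F : fieldType) (S T L : lieSuperalgType F)
    (E : extension S T L) : Prop :=
  is_stem E /\
  exists2 d, has_sdim S d &
    forall (S' T' : lieSuperalgType F) (E' : extension S' T' L) e,
      is_stem E' -> has_sdim S' e -> sdim_le d e -> e = d.

Definition is_multiplier (F : fieldType) (L M : lieSuperalgType F) : Prop :=
  exists (C : lieSuperalgType F) (E : extension M C L), is_maximal_stem E.

Definition is_cover (F : fieldType) (L C : lieSuperalgType F) : Prop :=
  exists (M : lieSuperalgType F) (E : extension M C L), is_maximal_stem E.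

(* P is free on some Z_2-graded set X, with parity map p.                     *)
Definition is_free_lie (F : fieldType) (P : lieSuperalgType F) : Prop :=
  exists (X : Type) (p : X -> bool) (i : X -> P),
    (forall x, i x \in homog (p x)) /\
    forall (K : lieSuperalgType F) (f : X -> K),
      (forall x, f x \in homog (p x)) ->
      exists phi : lieHom P K,
        (forall x, phi (i x) = f x) /\
        forall psi : lieHom P K, (forall x, psi (i x) = f x) -> psi =1 phi.

(* Main.v *)
From HB Require Import structures.
Require Import Defs.
From mathcomp Require Import all_boot all_order all_algebra.
From mathcomp Require Import boolp.

(** Everything rests on one construction.  Let b : B -> L be a surjective
    homomorphism whose kernel is central in B, and put N = ker b /\ [B, B].
    Call Y, a graded subspace of B containing [B, B], a complement for b if
    B = Y + ker b and Y /\ ker b lies in [B, B].  Such a Y is a subalgebra, and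

    - N -> Y -> L is a stem extension: as B = Y + ker b with ker b central,
      [B, B] = [Y, Y], so that N is contained in [Y, Y]
      (stem_of_complement);

    - if S -> T -> L is a stem extension and phi : B -> T is a homomorphism over
      L, then T = phi(B) + S with S central, so [T, T] = phi([B, B]), and
      phi maps N onto S (stem_kernel_surj).

    If S -> T -> L is moreover maximal, comparing superdimensions forces N -> S
    to be bijective, and then Y -> T is bijective as well (maximal_stem_iso).
    The point is that the same Y serves all phi at once.

    Uniqueness.  Given two maximal stem extensions S1 -> T1 -> L and
    S2 -> T2 -> L, let B be the pullback of T1 and T2 over L.  It maps to L with
    central kernel, and to both T1 and T2 over L; thus S1 = N = S2 and
    T1 = Y = T2 up to isomorphism (maximal_stem_unique).

    Existence.  The kernel S of a stem extension lies in [T, T], which is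
    spanned by the brackets of lifts of a basis of L because S is central;
    hence the superdimension of S is bounded (stem_sdim), and a kernel of
    maximal total dimension is maximal (maximal_stem_exists).

    Free presentations.  For R -> P -> L with P free, take B = P/[R, P].
    Freeness provides a map from B over L to every stem extension of L, so N
    surjects onto every stem kernel and N -> Y -> L is itself maximal
    (universal_stem_maximal).  Here N is (R /\ [P, P])/[R, P].  If X is a stem
    denominator and Y contains [P, P] and satisfies P/[R, P] = X/[R, P] + Y/[R, P]
    as a direct sum, then Y/[R, P] is a complement for b.  Both formulas follow
    by uniqueness. *)

Set Implicit Arguments.
Unset Strict Implicit.
Unset Printing Implicit Defensive.

Import GRing.Theory.
Local Open Scope ring_scope.

(** * Dimensions of modules that need not be finite-dimensional a priori *)

Section LinearAlgebra.
Variable F : fieldType.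

Definition linear_of (U V : lmodType F) (f : U -> V) (fL : linear f) :
  {linear U -> V} := HB.pack f (GRing.isLinear.Build F U V *:%R f fL).

(** Among the elements of {vspace V} that lie in A, one of largest
    dimension must contain every element of A. *)
Lemma vspace_of_subspace (V : vectType F) (A : V -> Prop) :
  A 0 -> (forall a x y, A x -> A y -> A (a *: x + y)) ->
  exists W : {vspace V}, forall x, x \in W <-> A x.
Proof.
move=> A0 Alin.
pose fits d := `[< exists2 W : {vspace V}, (forall x, x \in W -> A x) & \dim W = d >].
have fits0 : exists d, fits d.
  exists 0%N; apply/asboolP; exists 0%VS; last exact: dimv0.
  by move=> x; rewrite memv0 => /eqP->.
have fits_le d : fits d -> (d <= \dim {:V})%N.
  by move=> /asboolP[W _ <-]; exact/dimvS/subvf.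
case: (ex_maxnP fits0 fits_le) => d /asboolP[W WA dW] dmax.
exists W => x; split=> [/WA //|Ax].
have: (\dim (W + <[x]>) <= \dim W)%N.
  rewrite dW; apply: dmax; apply/asboolP; exists (W + <[x]>)%VS => //.
  move=> _ /memv_addP[w Ww [_ /vlineP[a ->] ->]].
  by rewrite addrC; apply: Alin => //; exact: WA.
move=> le_dim; have : W == (W + <[x]>)%VS by rewrite eqEdim addvSl.
by move=> /eqP->; apply: (subvP (addvSr W <[x]>)); exact: memv_line.
Qed.

Lemma linear_factor_inj (U V W : lmodType F) (g : {linear U -> W})
    (j : {linear V -> W}) :
  injective j -> (forall u, exists v, j v = g u) ->
  exists h : {linear U -> V}, forall u, j (h u) = g u.
Proof.
move=> jI /choice[h hE].
have hL : linear h by move=> a x y; apply: jI; rewrite linearP !hE linearP.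
by exists (linear_of hL).
Qed.

Lemma axiom_dim_le (n m : nat) (V W : lmodType F) (f : {linear V -> W}) :
  Vector.axiom n V -> Vector.axiom m W -> injective f -> (n <= m)%N.
Proof.
move=> [v vL [v' vK v'K]] [w wL [w' wK w'K]] fI.
pose hf := w \o f \o v'.
have v'L : linear v' by exact: (can2_linear (f := linear_of vL) vK v'K).
have hL : linear hf by move=> a x y; rewrite /hf /= v'L linearP wL.
pose h := linear_of hL.
have hI : injective h.
  by apply: inj_comp; [apply: inj_comp; [exact: can_inj wK|] | exact: can_inj v'K].
have /lker0P/eqP kh : injective (linfun h) by move=> x y; rewrite !lfunE; exact: hI.
have := limg_dim_eq (f := linfun h) (U := {:'rV[F]_n}).
rewrite kh capv0 => /(_ erefl); have := dimvS (subvf (linfun h @: fullv)).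
by rewrite !dimvf !dim_matrix !mul1r => le <-.
Qed.

(** A complement of the kernel is mapped bijectively onto V; its dimension is
    that of U only if the kernel vanishes. *)
Lemma vect_quot (U : vectType F) (V : lmodType F) (f : {linear U -> V}) :
  (forall v, exists u, f u = v) ->
  exists m, [/\ (m <= dim U)%N, inhabited (Vector.axiom m V) &
    m = dim U -> injective f].
Proof.
move=> fS.
have [K KP] : exists K : {vspace U}, forall x, x \in K <-> f x = 0.
  apply: vspace_of_subspace; first exact: raddf0.
  by move=> a x y fx fy; rewrite linearP fx fy scaler0 addr0.
pose C := (K^C)%VS.
have fCI (x y : subvs_of C) : f (vsval x) = f (vsval y) -> x = y.
  move=> e; apply: val_inj; apply/eqP; rewrite -subr_eq0 -memv0 -(capv_compl K).
  rewrite memv_cap; apply/andP; split; first by apply/KP; rewrite linearB e subrr.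
  by rewrite rpredB ?subvsP.
have fCS y : exists c : subvs_of C, f (vsval c) = y.
  have [x <-] := fS y; have : x \in (K + C)%VS by rewrite addv_complf memvf.
  move=> /memv_addP[k /KP fk [c Cc ->]]; exists (Subvs Cc).
  by rewrite linearD fk add0r.
have [s sE] := choice fCS.
have sL : linear s by move=> a x y; apply: fCI; rewrite !(linearP, sE).
have sB : bijective s.
  by exists (f \o vsval) => [y|c]; [exact: sE | apply: fCI; exact: sE].
have [w wL wB] := subvs_vect_iso C.
exists (\dim C); split.
- by rewrite -dimvf; exact/dimvS/subvf.
- constructor; exists (w \o s); last exact: bij_comp.
  by move=> a x y; rewrite /= sL wL.
move=> dC x y e; have CE : C = fullv by apply/eqP; rewrite eqEdim subvf dC dimvf leqnn.
have K0 : K = 0%VS by rewrite -(capv_compl K) -/C CE capvf.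
by apply/eqP; rewrite -subr_eq0 -memv0 -K0; apply/KP; rewrite linearB e subrr.
Qed.

Lemma axiom_quot (n : nat) (U V : lmodType F) (f : {linear U -> V}) :
  Vector.axiom n U -> (forall v, exists u, f u = v) ->
  exists m, [/\ (m <= n)%N, inhabited (Vector.axiom m V) & m = n -> injective f].
Proof.
move=> Un fS.
pose UV : vectType F := HB.pack U (Lmodule_hasFinDim.Build F U Un).
exact: (@vect_quot UV V f fS).
Qed.

(** V embeds in the image of g, hence is a quotient of the finite-dimensional
    space of those u for which g u comes from V. *)
Lemma axiom_sub (U : vectType F) (V W : lmodType F) (g : {linear U -> W})
    (j : {linear V -> W}) :
  injective j -> (forall v, exists u, g u = j v) ->
  exists2 m, (m <= dim U)%N & inhabited (Vector.axiom m V).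
Proof.
move=> jI jg.
have [D DP] : exists D : {vspace U}, forall x, x \in D <-> exists v, j v = g x.
  apply: vspace_of_subspace; first by exists 0; rewrite !raddf0.
  by move=> a x y [v jv] [w jw]; exists (a *: v + w); rewrite !linearP jv jw.
have DL : linear (g \o vsval : subvs_of D -> W) by move=> a x y; rewrite /= !linearP.
have [|h hE] := linear_factor_inj
  (g := linear_of DL) jI.
  by move=> u; apply/DP/subvsP.
have hS v : exists u, h u = v.
  have [u e] := jg v; have Du : u \in D by apply/DP; exists v.
  by exists (Subvs Du); apply: jI; rewrite hE.
have [m [le_m Vm _]] := vect_quot hS.
by exists m => //; apply: (leq_trans le_m); rewrite -[dim U]dimvf; exact/dimvS/subvf.
Qed.

End LinearAlgebra.

(** * Homomorphisms of Lie superalgebras *)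

Section Homomorphisms.
Variable F : fieldType.
Implicit Types A B K : lieSuperalgType F.

Section Additivity.
Variables (A B : lieSuperalgType F) (f : lieHom A B).
Lemma lie0 : f 0 = 0. Proof. exact: linear0. Qed.
Lemma lieD x y : f (x + y) = f x + f y. Proof. exact: linearD. Qed.
Lemma lieB x y : f (x - y) = f x - f y. Proof. exact: linearB. Qed.
Lemma lieZ a x : f (a *: x) = a *: f x. Proof. exact: linearZ. Qed.
Lemma lie_sum (T : Type) (s : seq T) (g : T -> A) :
  f (\sum_(p <- s) g p) = \sum_(p <- s) f (g p).
Proof. exact: linear_sum. Qed.
Lemma lie_inj : (forall x, f x = 0 -> x = 0) -> injective f.
Proof.
by move=> ker0 x y e; apply/eqP; rewrite -subr_eq0; apply/eqP/ker0; rewrite lieB e subrr.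
Qed.

Lemma lie_preimage_homog : (forall y, exists x, f x = y) ->
  forall b y, y \in homog b -> exists2 x, x \in homog b & f x = y.
Proof.
move=> fS b y hy; have [x fx] := fS y; have [x0 [x1 [h0 h1 e]]] := homog_decomp x.
have e' : f x0 + f x1 = y by rewrite -lieD -e.
case: b hy => hy; [exists x1 | exists x0] => //.
  have := homog_uniq (lie_homog f h0) (lie_homog f h1) (homog0 _ _) hy.
  by rewrite e' add0r => /(_ erefl)[].
have := homog_uniq (lie_homog f h0) (lie_homog f h1) hy (homog0 _ _).
by rewrite e' addr0 => /(_ erefl)[].
Qed.

End Additivity.

Lemma lie_id_subproof A : linear (@id A). Proof. by []. Qed.
Definition lie_id A : lieHom A A :=
  @LieHom F A A (linear_of (@lie_id_subproof A)) (fun _ _ => id) (fun _ _ => erefl).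

Lemma lie_comp A B K (g : lieHom B K) (f : lieHom A B) :
  exists h : lieHom A K, forall x, h x = g (f x).
Proof.
have hL : linear (g \o f) by move=> a x y; rewrite /= !(lieD, lieZ).
unshelve eexists (@LieHom F A K (linear_of hL) _ _) => //.
- by move=> b x hx; do 2!apply: lie_homog.
- by move=> x y /=; rewrite !lie_brk.
Qed.

(** The map g is determined by j \o g = f, and it is even because j, being
    even and injective, reflects parity. *)
Lemma lie_factor_inj A B K (f : lieHom A K) (j : lieHom B K) :
  injective j -> (forall x, exists y, j y = f x) ->
  exists g : lieHom A B, forall x, j (g x) = f x.
Proof.
move=> jI /(linear_factor_inj jI)[g gE].
unshelve eexists (@LieHom F A B g _ _) => //.
- move=> b x hx; have [y0 [y1 [h0 h1 e]]] := homog_decomp (g x).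
  have e' : j y0 + j y1 = f x by rewrite -lieD -e gE.
  have hf : f x \in homog b by exact: lie_homog.
  rewrite e; case: b {hx} hf => hf.
    have [] := homog_uniq (lie_homog j h0) (lie_homog j h1) (homog0 _ _) hf.
      by rewrite e' add0r.
    by rewrite -(lie0 j) => /jI-> _; rewrite add0r.
  have [] := homog_uniq (lie_homog j h0) (lie_homog j h1) hf (homog0 _ _).
    by rewrite e' addr0.
  by rewrite -(lie0 j) => _ /jI->; rewrite addr0.
- by move=> x y; apply: jI; rewrite lie_brk !gE lie_brk.
Qed.

Lemma lie_factor_surj A B K (p : lieHom A B) (f : lieHom A K) :
  (forall y, exists x, p x = y) -> (forall x, p x = 0 -> f x = 0) ->
  exists g : lieHom B K, forall x, g (p x) = f x.
Proof.
move=> pS kerP; have [s sE] := choice pS.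
have fs x : f (s (p x)) = f x.
  by apply/eqP; rewrite -subr_eq0 -lieB; apply/eqP/kerP; rewrite lieB sE subrr.
have gL : linear (f \o s).
  move=> a x y; rewrite /= -lieZ -lieD; rewrite -(fs (a *: s x + s y)).
  by rewrite lieD lieZ !sE.
unshelve eexists (@LieHom F B K (linear_of gL) _ _) => //=.
- move=> b y /(lie_preimage_homog pS)[x hx <-] /=.
  by rewrite fs; exact: lie_homog.
- by move=> x y; rewrite -lie_brk -(fs \[s x, s y]) lie_brk !sE.
Qed.

Definition incl_linear A (K : subalgebra A) :
    linear (@subsp_val F A K : sub_lie K -> A) :=
  fun _ _ _ => erefl.

Definition incl_hom A (K : subalgebra A) : lieHom (sub_lie K) A :=
  @LieHom F (sub_lie K) A (linear_of (@incl_linear A K))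
    (fun _ _ hx => hx) (fun _ _ => erefl).

Lemma incl_homE A (K : subalgebra A) x : incl_hom K x = subsp_val x.
Proof. reflexivity. Qed.

Lemma incl_hom_inj A (K : subalgebra A) : injective (incl_hom K).
Proof. exact: val_inj. Qed.

Lemma lie_iso_of A B (f : lieHom A B) :
  injective f -> (forall y, exists x, f x = y) -> lie_iso A B.
Proof.
move=> fI fS; exists f; have [g gE] := choice fS.
by exists g => [x|]; [apply: fI|].
Qed.

Lemma lie_iso_sym A B : lie_iso A B -> lie_iso B A.
Proof.
move=> [f [g fK gK]].
have [|h hE] := lie_factor_inj (f := lie_id B) (can_inj fK).
  by move=> y; exists (g y); rewrite gK.
apply: (lie_iso_of (f := h)) => [x y e|x].
  by have := hE x; rewrite e hE.
by exists (f x); apply: (can_inj fK); rewrite hE.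
Qed.

Lemma lie_iso_trans A B K : lie_iso A B -> lie_iso B K -> lie_iso A K.
Proof.
move=> [f fB] [g gB]; have [h hE] := lie_comp g f.
by exists h; apply: (eq_bij (bij_comp gB fB)).
Qed.

Lemma homog_part A B (f : lieHom A B) b :
  exists g : {linear subsp (homog_space A b) -> subsp (homog_space B b)},
    forall x, subsp_val (g x) = f (subsp_val x).
Proof.
have fh (x : subsp (homog_space A b)) : f (subsp_val x) \in homog_space B b.
  exact: lie_homog (subsp_valP x).
have gL : linear (fun x => Subsp (fh x)).
  by move=> a x y; apply: val_inj; rewrite /= lieD lieZ.
by exists (linear_of gL).
Qed.

(** The comparison is made in each parity separately; when both dimensions
    agree, f is injective on each homogeneous part, hence injective. *)
Lemma sdim_surj A B (f : lieHom A B) d e :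
  (forall y, exists x, f x = y) -> has_sdim A d -> has_sdim B e ->
  sdim_le e d /\ (e = d -> injective f).
Proof.
move=> fS [[A0] [A1]] [[B0] [B1]].
have part b n m : Vector.axiom n (subsp (homog_space A b)) ->
    Vector.axiom m (subsp (homog_space B b)) ->
    (m <= n)%N /\ (m = n -> forall x, x \in homog b -> f x = 0 -> x = 0).
  move=> An Bm; have [g gE] := homog_part f b.
  have [|k [le_kn [Bk] gI]] := axiom_quot (f := g) An.
    move=> [y hy]; have [x hx fx] := lie_preimage_homog fS hy.
    by exists (Subsp (hx : x \in homog_space A b)); apply: val_inj; rewrite /= gE.
  have idI : injective (idfun : {linear subsp (homog_space B b) -> subsp (homog_space B b)}) by [].
  have -> : m = k.
    by apply/eqP; rewrite eqn_leq (axiom_dim_le Bm Bk idI) (axiom_dim_le Bk Bm idI).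
  split=> // /gI gI' x hx fx.
  suff: Subsp (hx : x \in homog_space A b) = 0 by move/(congr1 (@subsp_val _ _ _)).
  by apply: gI'; rewrite raddf0; apply: val_inj; rewrite /= gE.
have [le0 inj0] := part _ _ _ A0 B0; have [le1 inj1] := part _ _ _ A1 B1.
split; first by rewrite /sdim_le le0.
move=> e_d; rewrite e_d in inj0 inj1; apply: lie_inj => x.
have [x0 [x1 [h0 h1 ->]]] := homog_decomp x => fx.
have := homog_uniq (lie_homog f h0) (lie_homog f h1) (homog0 _ _) (homog0 _ _).
rewrite -lieD fx addr0 => /(_ erefl)[/(inj0 erefl _ h0)-> /(inj1 erefl _ h1)->].
by rewrite addr0.
Qed.

Lemma sdim_exists A (N : nat) :
  (forall b, exists2 m, (m <= N)%N & inhabited (Vector.axiom m (subsp (homog_space A b)))) ->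
  exists2 d, has_sdim A d & (d.1 + d.2 <= N + N)%N.
Proof.
move=> H; have [m le_m Am] := H false; have [k le_k Ak] := H true.
by exists (m, k); rewrite ?leq_add.
Qed.

End Homomorphisms.

(** * Center, derived algebra and stem extensions *)

Section CenterDerived.
Variable F : fieldType.
Implicit Types A B : lieSuperalgType F.

Lemma centerP A (x : A) : x \in center A <-> forall y, \[x, y] = 0.
Proof. by rewrite inE; split=> [/asboolP|?] //; apply/asboolP. Qed.

(** Skew-symmetry holds for homogeneous elements only.  It applies because the
    homogeneous components of x are central too: their brackets with a
    homogeneous z have different parities and add up to 0. *)
Lemma center_brkr A (x y : A) : x \in center A -> \[y, x] = 0.
Proof.
move=> /centerP xC; have [x0 [x1 [h0 h1 e]]] := homog_decomp x.
have part b z : z \in homog b -> \[z, x] = 0.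
  move=> hz; have e' : \[x0, z] + \[x1, z] = 0 by rewrite -brkDl -e.
  have [z0 z1] : \[x0, z] = 0 /\ \[x1, z] = 0.
    have := brk_homog h0 hz; have := brk_homog h1 hz.
    case: b {hz} => /= k1 k0; rewrite ?addr0 in e'.
      have [] := homog_uniq k1 k0 (homog0 _ _) (homog0 _ _); last by [].
      by rewrite addrC e' addr0.
    have [] := homog_uniq k0 k1 (homog0 _ _) (homog0 _ _); last by [].
    by rewrite e' addr0.
  by rewrite e brkDr (brk_skew hz h0) (brk_skew hz h1) z0 z1 !scaler0 oppr0 addr0.
have [y0 [y1 [k0 k1 ->]]] := homog_decomp y.
by rewrite brkDl (part _ _ k0) (part _ _ k1) addr0.
Qed.

Lemma brk_derived A (x y : A) : \[x, y] \in derived A.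
Proof. exact: mem_comm. Qed.

Lemma derived_hom A B (f : lieHom A B) x : x \in derived A -> f x \in derived B.
Proof.
move=> /comm_memP[s [_ ->]]; rewrite lie_sum; apply: ss_sum => p _.
by rewrite lie_brk; exact: brk_derived.
Qed.

(** If f is surjective up to the center then a bracket in B is not changed when
    its two arguments are replaced by elements of the image of f. *)
Lemma derived_lift A B (f : lieHom A B) :
  (forall y, exists x, y - f x \in center B) ->
  forall y, y \in derived B -> exists2 x, x \in derived A & f x = y.
Proof.
move=> /choice[g gC] y /comm_memP[s [_ ->]].
exists (\sum_(p <- s) \[g p.1, g p.2]).
  by apply: ss_sum => p _; exact: brk_derived.
rewrite lie_sum; apply: eq_bigr => p _; rewrite lie_brk.
rewrite -{2}[p.1](subrK (f (g p.1))) -{2}[p.2](subrK (f (g p.2))).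
rewrite brkDl (iffLR (centerP _) (gC p.1)) add0r brkDr.
by rewrite (center_brkr _ (gC p.2)) add0r.
Qed.

Section Extension.
Variables (S T L : lieSuperalgType F) (E : extension S T L).

Lemma ext_idealP x : x \in ext_ideal E <-> ext_proj E x = 0.
Proof.
split=> [/img_memP[a _ <-]|/(ext_exact E)[a <-]]; last by apply/img_memP; exists a.
by apply/(ext_exact E); exists a.
Qed.

Lemma ext_proj_inj a : ext_proj E (ext_inj E a) = 0.
Proof. by apply/ext_exact; exists a. Qed.

Lemma stemP : is_stem E <->
  forall x, ext_proj E x = 0 -> x \in center T /\ x \in derived T.
Proof.
split=> [[EC ED] x /ext_idealP Ex|EP]; first by split; [exact: EC | exact: ED].
by split=> x /ext_idealP/EP[].
Qed.

(** Let t_i lift the i-th basis vector of L.  Since the kernel is central, [T, T]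
    is spanned by the n * n brackets [t_i, t_j], and the kernel lies in
    [T, T].  This bounds the dimension of each homogeneous part of S. *)
Lemma stem_sdim n : Vector.axiom n L -> is_stem E ->
  exists2 d, has_sdim S d & (d.1 + d.2 <= n * n + n * n)%N.
Proof.
move=> [v vL [w vK wK]] /stemP Est; apply: sdim_exists => b.
have [t tE] := choice (ext_proj_surjective E).
pose e i := t (w (delta_mx 0 i)).
(* A matrix is the family of coefficients of a combination of brackets. *)
pose gf (M : 'M[F]_n) : T := \sum_i \sum_j M i j *: \[e i, e j].
have gL : linear gf.
  move=> a M N; rewrite /gf scaler_sumr -big_split; apply: eq_bigr => i _ /=.
  rewrite scaler_sumr -big_split; apply: eq_bigr => j _ /=.
  by rewrite !mxE scalerDl scalerA.
pose comb (r : 'rV[F]_n) : T := \sum_i r 0 i *: e i.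
have wL : linear w := can2_linear (f := linear_of vL) vK wK.
have combE r : ext_proj E (comb r) = w r.
  rewrite /comb lie_sum [r in RHS]row_sum_delta -[RHS]/(linear_of wL _) linear_sum.
  by apply: eq_bigr => i _; rewrite lieZ linearZ /e tE.
have combP x : x - comb (v (ext_proj E x)) \in center T.
  suff: ext_proj E (x - comb (v (ext_proj E x))) = 0 by move=> /Est[].
  by rewrite lieB combE vK subrr.
have gD x : x \in derived T -> exists M, linear_of gL M = x.
  move=> /comm_memP[s [_ ->]]; elim: s => [|[x1 x2] s [M gM]].
    by exists 0; rewrite linear0 big_nil.
  pose r := v (ext_proj E x1); pose r' := v (ext_proj E x2).
  exists (\matrix_(i, j) (r 0 i * r' 0 j) + M); rewrite linearD gM big_cons; congr (_ + _).
  have -> : \[x1, x2] = \[comb r, comb r'].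
    rewrite -[x1 in LHS](subrK (comb r)) -[x2 in LHS](subrK (comb r')).
    rewrite brkDl (iffLR (centerP _) (combP x1)) add0r brkDr.
    by rewrite (center_brkr _ (combP x2)) add0r.
  rewrite /= /gf /comb (big_morph (fun x => \[x, _]) (fun x y => brkDl x y _) (brk0l _)).
  apply: eq_bigr => i _; rewrite (big_morph (brk _) (brkDr _) (brk0r _)).
  by apply: eq_bigr => j _; rewrite brkZl brkZr scalerA mxE.
have jL : linear (fun x : subsp (homog_space S b) => ext_inj E (subsp_val x)).
  by move=> a x y; rewrite /= lieD lieZ.
have [||m] := axiom_sub (g := linear_of gL) (j := linear_of jL).
- by move=> x y /= /(ext_inj_injective (e := E)) /val_inj.
- by move=> x; apply: gD; have [] := Est _ (ext_proj_inj (subsp_val x)).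
by rewrite dim_matrix => le_m; exists m.
Qed.

End Extension.
End CenterDerived.

(** * The stem extensions carried by a central surjection *)

Section CentralSurjection.
Variables (F : fieldType) (B L : lieSuperalgType F) (b : lieHom B L).
Hypothesis bS : forall y, exists x, b x = y.
Hypothesis bC : forall x, b x = 0 -> x \in center B.

Variable N : subalgebra B.
Hypothesis NP : forall x, x \in N <-> b x = 0 /\ x \in derived B.

Variable Y : subalgebra B.
Hypothesis YD : {subset derived B <= Y}.
Hypothesis YS : forall x, exists2 y, y \in Y & b (x - y) = 0.
Hypothesis YN : forall y, y \in Y -> b y = 0 -> y \in derived B.

(** Centrality of ker b gives [B, B] = [Y, Y], so the kernel, which lies in
    [B, B] by the choice of Y, lies in the derived algebra of Y. *)
Lemma stem_of_complement :
  exists E : extension (sub_lie N) (sub_lie Y) L, is_stem E.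
Proof.
have [|i iE] := lie_factor_inj (f := incl_hom N) (j := incl_hom Y) (@incl_hom_inj _ _ Y).
  move=> x; have [_ /YD Dx] := iffLR (NP _) (subsp_valP x).
  by exists (Subsp Dx).
have [p pE] := lie_comp b (incl_hom Y).
have iI : injective i.
  by move=> x y e; apply: (@incl_hom_inj _ _ N); rewrite -!iE e.
have pS y : exists x, p x = y.
  have [x <-] := bS y; have [z Yz e] := YS x; exists (Subsp Yz).
  by rewrite pE; apply/esym/eqP; rewrite -subr_eq0 -lieB; apply/eqP.
have ex x : p x = 0 <-> exists a, i a = x.
  rewrite pE; split=> [bx|[a <-]]; last first.
    by rewrite iE; have [] := iffLR (NP _) (subsp_valP a).
  have Nx : incl_hom Y x \in N by apply/NP; split=> //; apply: YN => //; exact: subsp_valP.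
  by exists (Subsp Nx); apply: (@incl_hom_inj _ _ Y); rewrite iE.
exists (Extension iI pS ex); apply/stemP => /= x; rewrite pE => bx.
split.
  by apply/centerP => y; apply: val_inj; apply: (iffLR (centerP _) (bC bx)).
have Dx : incl_hom Y x \in derived B by apply: YN => //; exact: subsp_valP.
have [|z Dz e] := derived_lift (f := incl_hom Y) _ Dx.
  by move=> z; have [y Yy /bC e] := YS z; exists (Subsp Yy).
by rewrite -(@incl_hom_inj _ _ Y _ _ e).
Qed.

Section OverStem.
Variables (S T : lieSuperalgType F) (E : extension S T L) (phi : lieHom B T).
Hypothesis Est : is_stem E.
Hypothesis phiE : forall x, ext_proj E (phi x) = b x.

(** An element of S lies in [T, T] = phi([B, B]); a preimage of it in [B, B]
    is killed by b, hence belongs to N. *)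
Lemma stem_kernel_hit s : exists2 x, x \in N & phi x = ext_inj E s.
Proof.
move: (Est) => /stemP Est'; have [_ Ds] := Est' _ (ext_proj_inj E s).
have [|x Dx e] := derived_lift (f := phi) _ Ds.
  move=> t; have [x bx] := bS (ext_proj E t); exists x.
  by have [] // := Est' (t - phi x); rewrite lieB phiE bx subrr.
by exists x => //; apply/NP; rewrite -phiE e ext_proj_inj.
Qed.

Lemma stem_kernel_surj : exists2 g : lieHom (sub_lie N) S,
  (forall x, ext_inj E (g x) = phi (subsp_val x)) & forall s, exists x, g x = s.
Proof.
have [f fE] := lie_comp phi (incl_hom N).
have [|g gE] := lie_factor_inj (f := f) (ext_inj_injective (e := E)).
  move=> x; apply/ext_exact; rewrite fE phiE.
  by have [] := iffLR (NP _) (subsp_valP x).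
exists g => [x|s]; first by rewrite gE fE.
have [x Nx e] := stem_kernel_hit s; exists (Subsp Nx).
by apply: (ext_inj_injective (e := E)); rewrite gE fE.
Qed.
End OverStem.

Section FiniteDimensional.
Hypothesis Lfin : finite_dimensional L.

(** As N is itself the kernel of a stem extension, maximality of S turns the
    surjection from N to S into a bijection.  The kernel of phi on Y then lies
    in Y /\ ker b, hence in N, where phi is injective; and phi(Y) contains
    phi(N) = S, so it is all of T. *)
Lemma maximal_stem_iso S T (E : extension S T L) (phi : lieHom B T) :
  is_maximal_stem E -> (forall x, ext_proj E (phi x) = b x) ->
  lie_iso (sub_lie N) S /\ lie_iso (sub_lie Y) T.
Proof.
move=> [Est [d Sd dmax]] phiE; have [n [Ln]] := Lfin.
have [E' E'st] := stem_of_complement; have [e Ne _] := stem_sdim Ln E'st.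
have [g gE gS] := stem_kernel_surj Est phiE.
have [le_de gI] := sdim_surj gS Ne Sd.
move: (gI (esym (dmax _ _ _ _ E'st Ne le_de))) => {}gI.
split; first exact: lie_iso_of gI gS.
have [h hE] := lie_comp phi (incl_hom Y).
apply: (lie_iso_of (f := h)).
  apply: lie_inj => y; rewrite hE => py.
  have by0 : b (incl_hom Y y) = 0 by rewrite -phiE py lie0.
  have Ny : incl_hom Y y \in N.
    by apply/NP; split=> //; apply: YN => //; exact: subsp_valP.
  have : Subsp Ny = 0 :> sub_lie N.
    by apply: gI; rewrite lie0; apply: (ext_inj_injective (e := E)); rewrite gE py lie0.
  by move/(congr1 (incl_hom N)); rewrite lie0 => e0; apply: val_inj.
move=> t; have [x bx] := bS (ext_proj E t); have [y Yy bxy] := YS x.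
have /ext_exact[s es] : ext_proj E (t - phi y) = 0.
  by rewrite lieB phiE -bx -lieB.
have [z Nz pz] := stem_kernel_hit Est phiE s.
have Yyz : y + z \in Y by apply: ssD => //; apply: YD; have [] := iffLR (NP z) Nz.
by exists (Subsp Yyz); rewrite hE incl_homE /= lieD pz es addrC subrK.
Qed.

(** The kernel N surjects onto every stem kernel, so its superdimension is not
    only maximal but the greatest. *)
Lemma universal_stem_maximal :
  (forall S T (E : extension S T L), is_stem E ->
     exists phi : lieHom B T, forall x, ext_proj E (phi x) = b x) ->
  exists E : extension (sub_lie N) (sub_lie Y) L, is_maximal_stem E.
Proof.
move=> univ; have [n [Ln]] := Lfin; have [E Est] := stem_of_complement.
have [d Nd _] := stem_sdim Ln Est; exists E; split=> //; exists d => // S T E' e E'st Se le_de.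
have [phi phiE] := univ _ _ _ E'st; have [g _ gS] := stem_kernel_surj E'st phiE.
have [/andP[le0 le1] _] := sdim_surj gS Nd Se; move/andP: le_de => [ge0 ge1].
by apply/eqP; rewrite -pair_eqE /pair_eq !eqn_leq le0 le1 ge0 ge1.
Qed.

End FiniteDimensional.
End CentralSurjection.

(** * Construction of graded subspaces *)

Lemma subsuperspace_of (F : fieldType) (V : superspaceType F) (A : V -> Prop) :
  A 0 -> (forall a x y, A x -> A y -> A (a *: x + y)) ->
  (forall x, A x -> exists x0 x1,
    [/\ A x0, A x1, x0 \in homog false, x1 \in homog true & x = x0 + x1]) ->
  exists K : subsuperspace V, forall x, x \in K <-> A x.
Proof.
move=> A0 Alin Agr; pose mem : V -> bool := fun x => `[< A x >].
have memP x : x \in mem <-> A x by split=> [/asboolP|?] //; apply/asboolP.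
have memC : submod_closed mem.
  split; first exact/memP.
  by move=> a x y /memP Ax /memP Ay; apply/memP/Alin.
pose Z : submodClosed V := HB.pack mem (GRing.isSubmodClosed.Build F V mem memC).
have Zgr x : x \in Z -> exists x0 x1,
    [/\ x0 \in Z, x1 \in Z, x0 \in homog false, x1 \in homog true & x = x0 + x1].
  move=> /memP/Agr[x0 [x1 [/memP A0x /memP A1x h0 h1 ->]]].
  by exists x0, x1.
by exists (Subsuperspace Zgr).
Qed.

(** An even map sends the homogeneous components of x to those of its image, so
    an equality between two even maps holds componentwise. *)
Lemma equalizer_graded (F : fieldType) (V : superspaceType F)
    (A : lieSuperalgType F) (f g : {linear V -> A}) :
  (forall p x, x \in homog p -> f x \in homog p) ->
  (forall p x, x \in homog p -> g x \in homog p) ->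
  exists K : subsuperspace V, forall x, x \in K <-> f x = g x.
Proof.
move=> fh gh; apply: subsuperspace_of; first by rewrite !linear0.
  by move=> a x y ex ey; rewrite !linearP ex ey.
move=> x; have [x0 [x1 [h0 h1 ->]]] := homog_decomp x; rewrite !linearD => e.
have [e0 e1] := homog_uniq (fh _ _ h0) (fh _ _ h1) (gh _ _ h0) (gh _ _ h1) e.
by exists x0, x1.
Qed.

Section StemComplement.
Variables (F : fieldType) (B L : lieSuperalgType F) (b : lieHom B L).

Lemma add_homog_line (Y : subsuperspace B) p (w : B) : w \in homog p ->
  exists Y' : subsuperspace B,
    forall x, x \in Y' <-> exists2 y, y \in Y & exists a, x = y + a *: w.
Proof.
move=> hw; apply: subsuperspace_of.
- by exists 0; [exact: ss0 | exists 0; rewrite scale0r addr0].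
- move=> c _ _ [y Yy [a ->]] [z Yz [d ->]].
  exists (c *: y + z); first by apply: ssD => //; exact: ssZ.
  by exists (c * a + d); rewrite scalerDr scalerA scalerDl addrACA.
move=> _ [y /ss_graded[y0 [y1 [Y0 Y1 h0 h1 ->]]] [a ->]].
have Yw z c : z \in Y -> exists2 y, y \in Y & exists a, z + c *: w = y + a *: w.
  by move=> Yz; exists z => //; exists c.
have Yid z : z \in Y -> exists2 y, y \in Y & exists a, z = y + a *: w.
  by move=> Yz; exists z => //; exists 0; rewrite scale0r addr0.
case: p hw => hw.
  exists y0, (y1 + a *: w); split=> //; [exact: Yid | exact: Yw | | exact/esym/addrA].
  by apply: homogD => //; exact: homogZ.
exists (y0 + a *: w), y1; split=> //; [exact: Yw | exact: Yid | | exact: addrAC].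
by apply: homogD => //; exact: homogZ.
Qed.

(** Among the graded Y that contain [B, B] and meet ker b inside [B, B], take one
    whose image in L has largest dimension.  A homogeneous w outside Y + ker b
    could be added to Y: in y + a *: w of the kernel, a nonzero a would put w in
    Y + ker b.  This would enlarge the image, so Y + ker b = B. *)
Lemma stem_complement_exists : finite_dimensional L ->
  exists Y : subsuperspace B,
  [/\ {subset derived B <= Y}, forall x, exists2 y, y \in Y & b (x - y) = 0
    & forall y, y \in Y -> b y = 0 -> y \in derived B].
Proof.
move=> [n [[v vL [v' vK _]]]].
pose vb (x : B) : 'rV[F]_n := v (b x).
have vbL : linear vb by move=> a x y; rewrite /vb lieD lieZ vL.
have vb_eq x y : vb x = vb y -> b (x - y) = 0.
  by move=> /(can_inj vK) e; rewrite lieB e subrr.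
pose good (Y : subsuperspace B) := {subset derived B <= Y} /\
  forall y, y \in Y -> b y = 0 -> y \in derived B.
pose fits d := `[< exists2 Y, good Y & exists2 W : {vspace 'rV[F]_n},
  (forall r, r \in W <-> exists2 y, y \in Y & vb y = r) & \dim W = d >].
have image (Y : subsuperspace B) : exists W : {vspace 'rV[F]_n},
    forall r, r \in W <-> exists2 y, y \in Y & vb y = r.
  apply: vspace_of_subspace; first by exists 0; [exact: ss0 | exact: (linear0 (linear_of vbL))].
  move=> a _ _ [x Yx <-] [y Yy <-]; exists (a *: x + y); last exact: vbL.
  by apply: ssD => //; exact: ssZ.
have fits_ex : exists d, fits d.
  have [W WP] := image (derived B); exists (\dim W); apply/asboolP.
  by exists (derived B); [split | exists W].
have fits_le d : fits d -> (d <= \dim {:'rV[F]_n})%N.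
  by move=> /asboolP[_ _ [W _ <-]]; exact/dimvS/subvf.
case: (ex_maxnP fits_ex fits_le) => d /asboolP[Y [YD YN] [W WP dW]] dmax.
exists Y; split=> //.
suff homog_ok p w : w \in homog p -> exists2 y, y \in Y & b (w - y) = 0.
  move=> x; have [x0 [x1 [/homog_ok[y0 Y0 e0] /homog_ok[y1 Y1 e1] ->]]] := homog_decomp x.
  by exists (y0 + y1); [exact: ssD | rewrite opprD addrACA lieD e0 e1 addr0].
move=> hw; apply: contrapT => wY.
have [Y' Y'P] := add_homog_line Y hw; have [W' W'P] := image Y'.
have YY' y : y \in Y -> y \in Y'.
  by move=> Yy; apply/Y'P; exists y => //; exists 0; rewrite scale0r addr0.
have gY' : good Y'.
  split=> [x /YD/YY' //|x /Y'P[y Yy [a ->]]].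
  have [->|a0] := eqVneq a 0; first by rewrite scale0r addr0; exact: YN.
  move=> bx; case: wY; exists (- a^-1 *: y); first exact: ssZ.
  by rewrite scaleNr opprK -[w](scalerK a0) -scalerDr lieZ addrC bx scaler0.
have WW' : (W <= W')%VS.
  by apply/subvP => _ /WP[y /YY' Yy <-]; apply/W'P; exists y.
have : W == W'.
  by rewrite eqEdim WW' dW dmax //; apply/asboolP; exists Y' => //; exists W'.
move=> /eqP WE; case: wY.
have /WP[y Yy e] : vb w \in W.
  rewrite WE; apply/W'P; exists w => //; apply/Y'P; exists 0; first exact: ss0.
  by exists 1; rewrite scale1r add0r.
by exists y => //; exact: vb_eq.
Qed.

Lemma stem_kernel_exists : exists N : subalgebra B,
  forall x, x \in N <-> b x = 0 /\ x \in derived B.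
Proof.
have [K KP] := @equalizer_graded F B L b \0 (lie_homog b) (fun _ _ _ => homog0 _ _).
have Kbr x y : x \in K -> y \in K -> \[x, y] \in K.
  by move=> /KP bx _; apply/KP; rewrite lie_brk bx brk0l.
exists (cap_subalg (Subalgebra Kbr) (derived B)) => x; rewrite mem_cap.
by split=> [/andP[/KP]|[bx ->]] //; rewrite andbT; apply/KP.
Qed.

End StemComplement.

(** * Products and pullbacks *)

Section Product.
Variables (F : fieldType).

Section Superspace.
Variables (U V : superspaceType F).
Definition prod_homog (p : bool) : {pred U * V} :=
  [pred x | (x.1 \in homog p) && (x.2 \in homog p)].

Fact prod_homog_closed p : submod_closed (prod_homog p).
Proof.
split; first by rewrite inE !homog0.
by move=> a x y; rewrite !inE => /andP[? ?] /andP[? ?]; rewrite !homogD ?homogZ.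
Qed.

Fact prod_homog_decomp (x : U * V) : exists x0 x1,
  [/\ x0 \in prod_homog false, x1 \in prod_homog true & x = x0 + x1].
Proof.
case: x => x y; have [x0 [x1 [h0 h1 ->]]] := homog_decomp x.
have [y0 [y1 [k0 k1 ->]]] := homog_decomp y.
by exists (x0, y0), (x1, y1); rewrite !inE h0 h1 k0 k1.
Qed.

Fact prod_homog_cap (x : U * V) :
  x \in prod_homog false -> x \in prod_homog true -> x = 0.
Proof.
case: x => x y; rewrite !inE /= => /andP[hx hy] /andP[kx ky].
by rewrite (homog_cap hx kx) (homog_cap hy ky).
Qed.

HB.instance Definition _ := Lmodule_isSuperspace.Build F (U * V)%type
  prod_homog_closed prod_homog_decomp prod_homog_cap.
End Superspace.

Variables (A B : lieSuperalgType F).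

Definition prod_brk (x y : A * B) : A * B := (\[x.1, y.1], \[x.2, y.2]).

Fact prod_brk_linearl z : linear (fun x => prod_brk x z).
Proof. by move=> a x y; rewrite /prod_brk /= !brkDl !brkZl. Qed.

Fact prod_brk_linearr z : linear (prod_brk z).
Proof. by move=> a x y; rewrite /prod_brk /= !brkDr !brkZr. Qed.

Fact prod_brk_homog p q (x y : A * B) :
  x \in homog p -> y \in homog q -> prod_brk x y \in homog (p (+) q).
Proof.
move=> /andP[x1 x2] /andP[y1 y2]; apply/andP.
by split; [exact: (brk_homog x1 y1) | exact: (brk_homog x2 y2)].
Qed.

Fact prod_brk_skew p q (x y : A * B) : x \in homog p -> y \in homog q ->
  prod_brk x y = - ((-1) ^+ (p && q) *: prod_brk y x).
Proof.
move=> /andP[x1 x2] /andP[y1 y2].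
by rewrite /prod_brk (brk_skew x1 y1) (brk_skew x2 y2).
Qed.

Fact prod_brk_jacobi p q r (x y z : A * B) :
  x \in homog p -> y \in homog q -> z \in homog r ->
  prod_brk x (prod_brk y z) = prod_brk (prod_brk x y) z
    + (-1) ^+ (p && q) *: prod_brk y (prod_brk x z).
Proof.
move=> /andP[x1 x2] /andP[y1 y2] /andP[z1 z2].
by rewrite /prod_brk /= (brk_jacobi x1 y1 z1) (brk_jacobi x2 y2 z2).
Qed.

HB.instance Definition _ := Superspace_isLieSuperalg.Build F (A * B)%type
  prod_brk_linearl prod_brk_linearr prod_brk_homog prod_brk_skew prod_brk_jacobi.

End Product.

Section Pullback.
Variables (F : fieldType) (T1 T2 L : lieSuperalgType F).
Variables (f1 : lieHom T1 L) (f2 : lieHom T2 L).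

(** The pullback is the subalgebra of T1 * T2 on which f1 and f2 agree.  The last
    clause makes it a central extension of L when T1 and T2 are. *)
Lemma pullback_exists :
  exists (B : lieSuperalgType F) (p1 : lieHom B T1) (p2 : lieHom B T2),
  [/\ forall x, f1 (p1 x) = f2 (p2 x),
      forall t1 t2, f1 t1 = f2 t2 -> exists2 x, p1 x = t1 & p2 x = t2
    & forall x, p1 x \in center T1 -> p2 x \in center T2 -> x \in center B].
Proof.
pose P : lieSuperalgType F := (T1 * T2)%type.
have g1L : linear (fun x : P => f1 x.1) by move=> a x y; rewrite /= lieD lieZ.
have g2L : linear (fun x : P => f2 x.2) by move=> a x y; rewrite /= lieD lieZ.
have [||Q QP] := @equalizer_graded F P L (linear_of g1L) (linear_of g2L).
- by move=> p x /andP[hx _]; exact: lie_homog.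
- by move=> p x /andP[_ hx]; exact: lie_homog.
have Qbr x y : x \in Q -> y \in Q -> \[x, y] \in Q.
  by move=> /QP /= ex /QP /= ey; apply/QP; rewrite /= !lie_brk ex ey.
pose K := Subalgebra Qbr.
have L1 : linear (fun x : sub_lie K => (subsp_val x).1) by [].
have L2 : linear (fun x : sub_lie K => (subsp_val x).2) by [].
have h1 p x : x \in homog p -> linear_of L1 x \in homog p by move=> /andP[].
have h2 p x : x \in homog p -> linear_of L2 x \in homog p by move=> /andP[].
exists (sub_lie K), (@LieHom F (sub_lie K) T1 (linear_of L1) h1 (fun _ _ => erefl)),
  (@LieHom F (sub_lie K) T2 (linear_of L2) h2 (fun _ _ => erefl)); split.
- by move=> x; exact: (iffLR (QP _) (subsp_valP x)).
- move=> t1 t2 e; have Kt : (t1, t2) \in K by apply/QP.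
  by exists (Subsp Kt).
move=> x /centerP c1 /centerP c2; apply/centerP => y; apply: val_inj.
by congr pair; [exact: c1 | exact: c2].
Qed.

End Pullback.

(** * Existence and uniqueness of maximal stem extensions *)

Section Uniqueness.
Variables (F : fieldType) (L : lieSuperalgType F).
Hypothesis Lfin : finite_dimensional L.

(** The total dimension d.1 + d.2 of a stem kernel is bounded, and a kernel for
    which it is largest is maximal for the partial order.  The identity of L
    is a central surjection, so there is at least one stem extension. *)
Lemma maximal_stem_exists : exists S T (E : extension S T L), is_maximal_stem E.
Proof.
have [n [Ln]] := Lfin.
pose fits k := `[< exists S T (E : extension S T L) d,
  [/\ is_stem E, has_sdim S d & (d.1 + d.2)%N = k] >].
have fits_ex : exists k, fits k.
  have idS (y : L) : exists x, lie_id L x = y by exists y.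
  have idC x : lie_id L x = 0 -> x \in center L.
    by move=> /= x0; apply/centerP => y; rewrite [x]x0 brk0l.
  have [N NP] := stem_kernel_exists (lie_id L).
  have [Y [YD YS YN]] := stem_complement_exists (lie_id L) Lfin.
  have [E Est] := @stem_of_complement F L L (lie_id L) idS idC N NP (subalg_of_derived YD) YD YS YN.
  have [d Nd _] := stem_sdim Ln Est; exists (d.1 + d.2)%N; apply/asboolP.
  by exists (sub_lie N), (sub_lie (subalg_of_derived YD)), E, d.
have fits_le k : fits k -> (k <= n * n + n * n)%N.
  move=> /asboolP[S [T [E [d [Est Sd <-]]]]].
  have [e Se le_e] := stem_sdim Ln Est.
  have [/andP[le1 le2] _] := sdim_surj (f := lie_id S) (fun y => ex_intro _ y erefl) Se Sd.
  exact: leq_trans (leq_add le1 le2) le_e.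
case: (ex_maxnP fits_ex fits_le) => k /asboolP[S [T [E [d [Est Sd dk]]]]] kmax.
exists S, T, E; split=> //; exists d => // S' T' E' e E'st Se /andP[le1 le2].
have : (e.1 + e.2 <= d.1 + d.2)%N.
  by rewrite dk; apply: kmax; apply/asboolP; exists S', T', E', e.
case: d e le1 le2 {Sd dk Se} => [d1 d2] [e1 e2] /= le1 le2 le.
have e1d : e1 = d1.
  by apply/eqP; rewrite eqn_leq le1 andbT -(leq_add2r d2); apply: leq_trans le; rewrite leq_add2l.
by move: le; rewrite e1d leq_add2l => le; congr pair; apply/eqP; rewrite eqn_leq le le2.
Qed.

(** Both extensions are compared with N -> Y -> L, where N and Y are taken in
    the pullback of T1 and T2 over L. *)
Lemma maximal_stem_unique S1 T1 S2 T2
    (E1 : extension S1 T1 L) (E2 : extension S2 T2 L) :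
  is_maximal_stem E1 -> is_maximal_stem E2 -> lie_iso S1 S2 /\ lie_iso T1 T2.
Proof.
move=> E1max E2max.
have [B [p1 [p2 [pE pS pC]]]] := pullback_exists (ext_proj E1) (ext_proj E2).
have [b bE] := lie_comp (ext_proj E1) p1.
have bE2 x : ext_proj E2 (p2 x) = b x by rewrite bE pE.
have bS y : exists x, b x = y.
  have [t1 e1] := ext_proj_surjective E1 y; have [t2 e2] := ext_proj_surjective E2 y.
  by have [|x x1 _] := pS t1 t2; [rewrite e1 | exists x; rewrite bE x1].
have bC x : b x = 0 -> x \in center B.
  move=> bx; apply: pC.
    by have [/stemP st _] := E1max; apply: (proj1 (st _ _)); rewrite -bE.
  by have [/stemP st _] := E2max; apply: (proj1 (st _ _)); rewrite bE2.
have [N NP] := stem_kernel_exists b.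
have [Y [YD YS YN]] := stem_complement_exists b Lfin.
have bE1 x : ext_proj E1 (p1 x) = b x by rewrite bE.
have iso := @maximal_stem_iso F B L b bS bC N NP (subalg_of_derived YD) YD YS YN Lfin.
have [N1 Y1] := iso _ _ _ _ E1max bE1; have [N2 Y2] := iso _ _ _ _ E2max bE2.
by split; [exact: lie_iso_trans (lie_iso_sym N1) N2 | exact: lie_iso_trans (lie_iso_sym Y1) Y2].
Qed.

End Uniqueness.

(** * The central quotient of a free presentation *)

Section FreePresentation.
Variables (F : fieldType) (L R0 P : lieSuperalgType F) (E : extension R0 P L).

(** Homogeneous lifts of the images of the generators define phi; that phi is
    a map over L is the uniqueness part of the universal property for L. *)
Lemma free_lift S T (E' : extension S T L) : is_free_lie P ->
  exists phi : lieHom P T, forall x, ext_proj E' (phi x) = ext_proj E x.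
Proof.
move=> [X [p [i [ip univ]]]].
have lift x : exists t, t \in homog (p x) /\ ext_proj E' t = ext_proj E (i x).
  have [] := lie_preimage_homog (ext_proj_surjective E') (lie_homog (ext_proj E) (ip x)).
  by move=> t; exists t.
have [f fE] := choice lift.
have [phi [phiE _]] := univ T f (fun x => proj1 (fE x)).
have [psi psiE] := lie_comp (ext_proj E') phi.
have [|chi [_ chiU]] := univ L (fun x => ext_proj E (i x)).
  by move=> x; exact: lie_homog.
exists phi => x; rewrite -psiE (chiU psi) ?(chiU (ext_proj E)) //.
by move=> y; rewrite psiE phiE; have [] := fE y.
Qed.

Let R := ext_ideal E.
Let RP := comm R (full P).

Lemma quot_map_surj (I : ideal P) y : exists x, quot_map I x = y.
Proof. exact: lquot_surj. Qed.

Lemma comm_kernel x : x \in RP -> ext_proj E x = 0.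
Proof.
move=> /comm_memP[s [sP ->]]; apply/ext_idealP; apply: ss_sum => q /sP[Rq _].
exact: id_closedl.
Qed.

Lemma central_quotient_exists : exists b : lieHom (quot_lie RP) L,
  forall x, b (quot_map RP x) = ext_proj E x.
Proof.
apply: lie_factor_surj; first exact: quot_map_surj.
by move=> x /lquot_pi_eq0; exact: comm_kernel.
Qed.

Variable b : lieHom (quot_lie RP) L.
Hypothesis bE : forall x, b (quot_map RP x) = ext_proj E x.

Lemma central_quotient_surj y : exists x, b x = y.
Proof. by have [x <-] := ext_proj_surjective E y; exists (quot_map RP x). Qed.

Lemma central_quotient_central q : b q = 0 -> q \in center (quot_lie RP).
Proof.
have [x <-] := quot_map_surj q; rewrite bE => /ext_idealP Rx.
apply/centerP => r; have [y <-] := quot_map_surj r.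
rewrite -lie_brk; apply/lquot_pi_eq0; exact: mem_comm.
Qed.

Lemma derived_quotP q : q \in derived (quot_lie RP) <->
  exists2 x, x \in derived P & quot_map RP x = q.
Proof.
split=> [|[x Dx <-]]; last exact: derived_hom.
apply: derived_lift => r; have [x <-] := quot_map_surj r.
by exists x; rewrite subrr; apply/centerP => y; exact: brk0l.
Qed.

Lemma central_quotient_kernel q :
  q \in img_subalg (quot_map RP) (cap_subalg R (derived P)) <->
  b q = 0 /\ q \in derived (quot_lie RP).
Proof.
split=> [/img_memP[x]|[bq /derived_quotP[x Dx e]]].
  rewrite mem_cap => /andP[/ext_idealP Ex Dx] <-; rewrite bE.
  by split=> //; exact: derived_hom.
apply/img_memP; exists x => //; rewrite mem_cap Dx andbT.
by apply/ext_idealP; rewrite -bE e.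
Qed.

(** A lift P -> T over L maps R into the central kernel of T, hence kills
    [R, P]. *)
Lemma central_quotient_lift S T (E' : extension S T L) :
  is_free_lie P -> is_stem E' ->
  exists phi : lieHom (quot_lie RP) T, forall q, ext_proj E' (phi q) = b q.
Proof.
move=> Pfree /stemP st; have [phi0 phi0E] := free_lift E' Pfree.
have [||phi phiE] := lie_factor_surj (p := quot_map RP) (f := phi0).
- exact: quot_map_surj.
- move=> x /lquot_pi_eq0/comm_memP[s [sP ->]]; rewrite lie_sum big_seq big1 // => q /sP[Rq _].
  rewrite lie_brk; apply: (iffLR (centerP _)); apply: (proj1 (st _ _)).
  by rewrite phi0E; apply/ext_idealP.
by exists phi => q; have [x <-] := quot_map_surj q; rewrite phiE phi0E bE.
Qed.

End FreePresentation.

Theorem theorem3p3 (F : fieldType)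
    (char_not2 : 2%N \notin [pchar F]) (char_not3 : 3%N \notin [pchar F])
    (L : lieSuperalgType F) (Lfin : finite_dimensional L) :
  exists M C : lieSuperalgType F,
  [/\ is_multiplier L M /\ (forall M', is_multiplier L M' -> lie_iso M' M),
      is_cover L C /\ (forall C', is_cover L C' -> lie_iso C' C) &
      forall (R0 P : lieSuperalgType F) (E : extension R0 P L),
        is_free_lie P ->
        let R := ext_ideal E in
        let RP := comm R (full P) in
        lie_iso M (quot_sub_lie RP (cap_subalg R (derived P))) /\
        forall (X Y : subsuperspace P) (hY : {subset derived P <= Y}),
          is_stem_denominator E X ->
          is_direct_sum (quot_ss RP (full P)) (quot_ss RP X) (quot_ss RP Y) ->
          lie_iso C (quot_sub_lie RP (subalg_of_derived hY))].
Proof.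
have [M [C [E0 E0max]]] := maximal_stem_exists Lfin.
exists M, C; split.
- split=> [|M' [C' [E' E'max]]]; first by exists C, E0.
  by have [] := maximal_stem_unique Lfin E'max E0max.
- split=> [|C' [M' [E' E'max]]]; first by exists M, E0.
  by have [] := maximal_stem_unique Lfin E'max E0max.
move=> R0 P E Pfree R RP; have [b bE] := central_quotient_exists E.
have bS := central_quotient_surj bE; have bC := central_quotient_central bE.
have NP := central_quotient_kernel bE.
have lift S T (E' : extension S T L) := central_quotient_lift bE (E' := E') Pfree.
have max (Y : subalgebra (quot_lie RP)) YD YS YN :=
  @universal_stem_maximal F _ L b bS bC _ NP Y YD YS YN Lfin lift.
split.
  have [Y [YD YS YN]] := stem_complement_exists b Lfin.
  have [E' E'max] := max (subalg_of_derived YD) YD YS YN.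
  by have [] := maximal_stem_unique Lfin E0max E'max.
move=> X Y hY [_ XR [Xspan _]] [Yspan XY0].
have XE x : x \in X -> b (quot_map RP x) = 0.
  by move=> /XR/ext_idealP; rewrite bE.
have [|||E' E'max] := max (img_subalg (quot_map RP) (subalg_of_derived hY)).
- by move=> _ /derived_quotP[x /hY Yx <-]; apply/img_memP; exists x.
- move=> q; have [|_ [_ [/img_memP[x Xx <-] /img_memP[y Yy <-] ->]]] := iffLR (Yspan q).
    by have [x <-] := quot_map_surj q; apply/img_memP; exists x.
  exists (quot_map RP y); first by apply/img_memP; exists y.
  by rewrite addrK XE.
(* Write q in R/[R, P] as u + v with u in N and v in X/[R, P]; then v = q - u
   lies in both X/[R, P] and Y/[R, P], so v = 0. *)
- move=> q Yq bq.
  have [|u [v [/NP[_ Du] Xv e]]] := iffLR (Xspan q).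
    have [r er] := quot_map_surj q; apply/img_memP; exists r => //.
    by apply/ext_idealP; rewrite -bE er.
  suff v0 : v = 0 by rewrite e v0 addr0.
  apply: XY0 => //; have -> : v = q - u by rewrite e addrC addKr.
  apply: subspB => //; have /derived_quotP[x /hY Yx <-] := Du.
  by apply/img_memP; exists x.
by have [] := maximal_stem_unique Lfin E0max E'max.
Qed.
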